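(* Let $\mathcal H\cong\mathbb C^d$ and let $\mathbb B_0,\mathbb B_1,\mathbb B_2$ be bases of $\mathcal H$ with $\mathbb B_1\succ^{\mathbb B_0}\mathbb B_2$. Then: (i) Let $\mathcal U,\mathcal V$ be unitary quantum maps with $\mathcal U(\mathbb B_1)=\mathbb B_0$ and $\mathcal V(\mathbb B_2)=\mathbb B_0$, and let $P_j\in\mathbb B_0$ be a pure state. Then $\mathcal V(P_j)$ can be transformed to $\mathcal U(P_j)$ via incoherent operations over $\mathbb B_0$, i.e. there is an incoherent operation $\mathcal E$ with respect to $\mathbb B_0$ such that $\mathcal E(\mathcal V(P_j))=\mathcal U(P_j)$. Consequently, every coherence measure $c$ with respect to $\mathbb B_0$ satisfies $c(\mathcal U(P_j))\le c(\mathcal V(P_j))$. (ii) For every state $\rho_0$ diagonal in $\mathbb B_0$, one has $c_{\mathbb B_1}(\rho_0)\le c_{\mathbb B_2}(\rho_0)$, where $c_{\mathbb B}$ denotes either the relative entropy of coherence $c^{(\mathrm{rel})}_{\mathbb B}$ or the 2-coherence $c^{(2)}_{\mathbb B}$ over $\mathbb B$ (the inequality holds for each of the two choices).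
   Context: A basis $\mathbb B$ of $\mathcal H\cong\mathbb C^d$ means a set $\mathbb B=\{P_i\}_{i=1}^d$ of rank-1 orthogonal projectors with $\sum_i P_i=I$. For bases $\mathbb B_1=\{P_i^{(1)}\}$, $\mathbb B_0=\{P_j^{(0)}\}$, $X(\mathbb B_1,\mathbb B_0)$ is the bistochastic matrix with entries $X_{ij}=\operatorname{Tr}(P_i^{(1)}P_j^{(0)})$ (defined up to the arbitrary enumeration of the bases). One writes $\mathbb B_1\succ^{\mathbb B_0}\mathbb B_2$ iff there is a bistochastic matrix $M$ with $X(\mathbb B_2,\mathbb B_0)=M X(\mathbb B_1,\mathbb B_0)$. A unitary quantum map (unitary superoperator) is $\mathcal U(Y)=UYU^\dagger$ with $U$ unitary on $\mathcal H$; it acts on a basis by $\mathcal U(\mathbb B)=\{\mathcal U(P_i)\}_i$ (equality of bases is equality of sets of projectors). A state is a density operator on $\mathcal H$; it is diagonal in (incoherent with respect to) $\mathbb B_0$ if it is of the form $\sum_i p_iP_i^{(0)}$. An incoherent operation with respect to $\mathbb B_0$ is a completely positive trace-preserving map admitting a Kraus representation $\mathcal E(\rho)=\sum_n K_n\rho K_n^\dagger$ such that, for every $n$ and every state $\rho$ diagonal in $\mathbb B_0$, $K_n\rho K_n^\dagger$ is diagonal in $\mathbb B_0$. A coherence measure with respect to $\mathbb B_0$ is a real-valued function on states that does not increase under incoherent operations with respect to $\mathbb B_0$. For a basis $\mathbb B=\{P_i\}$ let $\mathcal D_{\mathbb B}(Y)=\sum_iP_iYP_i$. The relative entropy of coherence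 is $c^{(\mathrm{rel})}_{\mathbb B}(\rho)=S(\rho\,\|\,\mathcal D_{\mathbb B}\rho)$, where $S(\rho\|\sigma)=\operatorname{Tr}(\rho\log\rho)-\operatorname{Tr}(\rho\log\sigma)$ is the quantum relative entropy. The 2-coherence is $c^{(2)}_{\mathbb B}(\rho)=\sum_{i\neq j}|\rho_{ij}|^2$, where $\rho_{ij}$ are the matrix elements of $\rho$ in an orthonormal basis of vectors corresponding to $\mathbb B$. *)

(* Defs.v *)
From mathcomp Require Import all_boot all_order all_algebra.
From mathcomp Require Import spectral.
From mathcomp Require Import complex.
From mathcomp Require Import all_classical all_reals all_analysis.

Set Implicit Arguments.
Unset Strict Implicit.
Unset Printing Implicit Defensive.

Import Order.TTheory GRing.Theory Num.Theory.
Local Open Scope ring_scope.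
Local Open Scope classical_set_scope.
Local Open Scope complex_scope.
Local Open Scope sesquilinear_scope.

Section Bases.
Variables (R : realType) (d : nat).
Local Notation C := R[i].
Implicit Types (B : 'I_d -> 'M[C]_d) (Y : 'M[C]_d).

(* A basis is given with an enumeration of its projectors.  Mutual
   orthogonality, hence injectivity of the enumeration, follows from the
   resolution of the identity. *)
Definition rank1_projector Y := [/\ Y ^t* = Y, Y *m Y = Y & \rank Y = 1%N].

Definition is_basis B :=
  (forall i, rank1_projector (B i)) /\ \sum_i B i = 1%:M.

Definition overlap B B' : 'M[C]_d := \matrix_(i, j) \tr (B i *m B' j).

(* In R[i], [0 <= z] says that z is real and nonnegative. *)
Definition bistochastic (M : 'M[C]_d) :=
  [/\ forall i j, 0 <= M i j,
      forall i, \sum_j M i j = 1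
    & forall j, \sum_i M i j = 1].

(* Independent of the enumerations: permutation matrices are bistochastic. *)
Definition majorizes B0 B1 B2 :=
  exists2 M : 'M[C]_d, bistochastic M & overlap B2 B0 = M *m overlap B1 B0.

End Bases.

Section Channels.
Variables (R : realType) (d : nat).
Local Notation C := R[i].
Implicit Types (B : 'I_d -> 'M[C]_d) (rho Y : 'M[C]_d) (E : 'M[C]_d -> 'M[C]_d).

Definition unitary_map E :=
  exists2 U : 'M[C]_d, U \is unitarymx & forall Y, E Y = U *m Y *m U ^t*.

(* Over R[i] the inequality forces A to be Hermitian. *)
Definition psdmx n (A : 'M[C]_n) :=
  forall v : 'cV[C]_n, 0 <= (v ^t* *m A *m v) 0 0.

Definition is_state rho := psdmx rho /\ \tr rho = 1.

(* For a state the coefficients are necessarily a probability vector. *)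
Definition diagonal_in B Y := exists p : 'I_d -> C, Y = \sum_i p i *: B i.

(* The block matrix of the (E (Y i j)) is the image of that of the (Y i j)
   under id_k (x) E. *)
Definition completely_positive E :=
  linear E /\
  forall (k : nat) (Y : 'I_k -> 'I_k -> 'M[C]_d),
    psdmx (\mxblock_(i < k, j < k) Y i j) ->
    psdmx (\mxblock_(i < k, j < k) E (Y i j)).

Definition trace_preserving E := forall Y, \tr (E Y) = \tr Y.

Definition incoherent_operation B E :=
  [/\ completely_positive E,
      trace_preserving E
    & exists (m : nat) (K : 'I_m -> 'M[C]_d),
        (forall rho, E rho = \sum_n K n *m rho *m (K n) ^t*) /\
        (forall n rho, is_state rho -> diagonal_in B rho ->
           diagonal_in B (K n *m rho *m (K n) ^t*))].

(* Only the values on states matter. *)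
Definition coherence_measure B (c : 'M[C]_d -> R) :=
  forall E, incoherent_operation B E ->
  forall rho, is_state rho -> c (E rho) <= c rho.

End Channels.

Section Coherences.
Variables (R : realType) (d : nat).
Local Notation C := R[i].
Implicit Types (B : 'I_d -> 'M[C]_d) (rho sigma Y W : 'M[C]_d).

Definition dephase B Y : 'M[C]_d := \sum_i B i *m Y *m B i.

(* Functional calculus for a Hermitian Y.  As [ln 0 = 0] in MathComp-Analysis,
   the logarithm vanishes on the kernel of a positive semidefinite Y, which
   implements the convention 0 log 0 = 0. *)
Definition mxlog Y : 'M[C]_d :=
  invmx (spectralmx Y)
  *m diag_mx (map_mx (fun z : C => (ln (complex.Re z))%:C) (spectral_diag Y))
  *m spectralmx Y.

(* Infinite unless the support of rho is included in that of sigma; for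
   Hermitian matrices this is the inclusion of row spaces. *)
Definition relative_entropy rho sigma : \bar R :=
  if (rho <= sigma)%MS then
    (complex.Re (\tr (rho *m mxlog rho) - \tr (rho *m mxlog sigma)))%:E
  else +oo%E.

Definition rel_coherence B rho : \bar R := relative_entropy rho (dephase B rho).

(* The columns of the unitary matrix W are unit vectors spanning the ranges
   of the B i. *)
Definition vector_basis_of B W :=
  W \is unitarymx /\ forall i, B i = col i W *m (col i W) ^t*.

(* The vectors are determined up to phases only; an arbitrary choice is made,
   see [vector_basis_exists] and [coherence2E]. *)
Definition vector_basis B : 'M[C]_d := xget 0 [set W | vector_basis_of B W].

Definition offdiag_sqnorm W rho : R :=
  \sum_i \sum_(j | j != i) complex.Re (`|(W ^t* *m rho *m W) i j| ^+ 2).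

Definition coherence2 B rho : R := offdiag_sqnorm (vector_basis B) rho.

Lemma vector_basis_exists B : is_basis B -> exists W, vector_basis_of B W.
Proof.
case=> proj sumB.
have vec i : exists v : 'cV[C]_d, B i = v *m v ^t*.
  have [hP _ rP] := proj i; set P := B i in hP rP *.
  set r := nz_row P.
  have r_neq0 : r != 0 by rewrite nz_row_eq0 -mxrank_eq0 rP.
  have /submxP [c Pc] : (P <= r)%MS.
    have /eqmx_sym : (r :=: P)%MS.
      apply/eqmxP; rewrite -(geq_leqif (mxrank_leqif_eq (nz_row_sub P))).
      by rewrite rP lt0n mxrank_eq0.
    by move=> ->.
  set s := (r *m r ^t*) 0 0.
  have s_ge0 : 0 <= s.
    rewrite /s mxE sumr_ge0 // => k _.
    by rewrite !mxE mul_conjC_ge0.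
  exists (sqrtC s *: c).
  have -> : P = P *m P ^t* by rewrite hP; have [_ -> _] := proj i.
  have -> : P *m P ^t* = s *: (c *m c ^t*).
    rewrite Pc trmx_mul map_mxM mulmxA -(mulmxA c r) [r *m _]mx11_scalar -/s.
    by rewrite mul_mx_scalar -scalemxAl.
  rewrite linearZ /= map_mxZ -scalemxAl -scalemxAr scalerA.
  congr (_ *: _).
  have /geC0_conj /= -> : 0 <= sqrtC s by rewrite sqrtC_ge0.
  by rewrite -expr2 sqrtCK.
have [v vP] := choice vec.
exists (\matrix_(k, i) v i k 0).
have colE i : col i (\matrix_(k, i) v i k 0) = v i.
  by apply/matrixP => k l; rewrite !mxE ord1.
split; last by move=> i; rewrite colE.
apply/unitarymxP; rewrite -sumB; apply/matrixP => k l.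
rewrite mxE summxE; apply: eq_bigr => i _.
by rewrite vP !mxE big_ord1 !mxE.
Qed.

Lemma coherence2E B W rho :
  vector_basis_of B W -> coherence2 B rho = offdiag_sqnorm W rho.
Proof.
have E W' i j : vector_basis_of B W' ->
    `|(W' ^t* *m rho *m W') i j| ^+ 2
    = \tr (B i *m rho *m B j *m rho ^t*) :> C.
  move=> [_ BW].
  set z := (X in `|X|).
  have zE : (col i W') ^t* *m rho *m col j W' = z%:M.
    rewrite [LHS]mx11_scalar /z; congr (_%:M).
    rewrite !mxE; apply: eq_bigr => k _; rewrite !mxE; congr (_ * _).
    by apply: eq_bigr => l _; rewrite !mxE.
  have zE' : (col j W') ^t* *m rho ^t* *m col i W' = (z^* )%:M.
    rewrite -[LHS](trmxCK) !trmx_mul !map_mxM /= !trmxCK mulmxA zE.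
    by rewrite tr_scalar_mx map_scalar_mx.
  have -> : B i *m rho *m B j *m rho ^t*
      = col i W' *m ((col i W') ^t* *m rho *m col j W'
                     *m ((col j W') ^t* *m rho ^t*)).
    by rewrite !BW !mulmxA.
  rewrite mxtrace_mulC -(mulmxA _ _ (col i W')) zE' zE -scalar_mxM.
  rewrite mxtrace_scalar mulr1n.
  by rewrite normCK.
move=> BW; rewrite /coherence2 /offdiag_sqnorm.
have BV : vector_basis_of B (vector_basis B) by apply: (xgetI 0 BW).
by apply: eq_bigr => i _; apply: eq_bigr => j _; rewrite !E.
Qed.

End Coherences.

(* Main.v *)
Require Import Defs.
From mathcomp Require Import all_boot all_order all_algebra all_fingroup.
From mathcomp Require Import spectral.
From mathcomp Require Import complex.
From mathcomp Require Import ring.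
From mathcomp Require Import all_classical all_reals all_analysis.

(* (i) In the eigenbasis of [B0], the squared moduli of the amplitudes of
   [V (B0 j)] and [U (B0 j)] are, up to permutations, the [j]-th columns of
   [overlap B2 B0] and [overlap B1 B0], so the former are majorized by the
   latter.  By Birkhoff's theorem the bistochastic matrix is a mixture of
   permutations [s] with weights [l s], and the operators
   [sqrt (l s) sum_i (y_(s i) / x_i) |s i><i|] are the Kraus operators of an
   incoherent operation sending the state of amplitudes [x] to the one of
   amplitudes [y]; the quotient is replaced by 1 where [x_i = 0].
   (ii) For [rho] diagonal in [B0] with outcome probabilities
   [r_i = tr (B i *m rho)], both coherences over [B] have the form
   [F rho - sum_i f (r_i)] with [F] independent of [B] and [f x = x ln x] or
   [f x = x ^ 2] convex.  The probabilities for [B2] are the image of those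
   for [B1] under a bistochastic matrix, so Jensen's inequality applies. *)

Set Implicit Arguments.
Unset Strict Implicit.
Unset Printing Implicit Defensive.

Import Order.TTheory GRing.Theory Num.Theory.
Local Open Scope ring_scope.
Local Open Scope classical_set_scope.
Local Open Scope complex_scope.
Local Open Scope sesquilinear_scope.

(** * Birkhoff's theorem by alternating cycles *)

(** Along a duplicate-free cycle, [next] is inverted by [prev]; off the cycle it fixes every
    point. *)
Lemma perm_rotate (T : finType) (e : rel T) (s : seq T) :
  ucycle e s -> exists u : {perm T},
    forall x, if x \in s then e x (u x) else u x == x.
Proof.
case/andP=> cs us.
exists (perm (can_inj (prev_next us))) => x; rewrite permE.
case: ifP => xs; first exact: next_cycle cs xs.
by apply/eqP; rewrite next_nth xs.
Qed.

Lemma cycle_of_connect (T : finType) (e : rel T) x y :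
  connect e x y -> e y x -> exists2 s, ucycle e s & x \in s.
Proof.
case/connectP=> p /shortenP[q pq uq _] -> eyx.
exists (x :: q); last exact: mem_head.
by rewrite /ucycle /= rcons_path pq eyx.
Qed.

Section Birkhoff.
Variables (F : realFieldType) (d : nat).
Implicit Types (M : 'M[F]_d) (c : F) (u : 'S_d).

(** The common sum [c] is arbitrary so that subtracting a multiple of a permutation matrix stays
    within the class, as Birkhoff's induction requires. *)
Definition equal_line_sums c M :=
  [/\ forall i j, 0 <= M i j,
      forall i, \sum_j M i j = c
    & forall j, \sum_i M i j = c].

(* If row i0 is not matched, the rows reachable from i0 along alternating
   steps carry, in their matched columns, all the mass of those columns; hence
   i0 lies on an alternating cycle, along which the permutation is rotated. *)
Lemma perm_augment c M u i0 :
  0 < c -> equal_line_sums c M -> M i0 (u i0) = 0 ->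
  exists v : 'S_d,
   (\sum_i (0 < M i (u i))%R < \sum_i (0 < M i (v i))%R)%N.
Proof.
move=> c_gt0 [M_ge0 rowM colM] Mi0.
pose e := [rel i k | 0 < M i (u k)].
pose S := [pred k | connect e i0 k].
have [k Sk ek] : exists2 k, k \in S & e k i0.
  have rowS i : i \in S -> c = \sum_(k in S) M i (u k).
    rewrite inE => Si; rewrite -(rowM i) (reindex_inj (@perm_inj _ u)) /=.
    rewrite (bigID (mem S)) /= [X in _ + X]big1 ?addr0 // => k.
    apply: contraNeq => Mk; rewrite inE; apply: connect_trans Si _.
    by apply: connect1; rewrite /= lt_def Mk M_ge0.
  have colS k : k \in S -> \sum_(i in S) M i (u k) = c.
    have colS_le j : \sum_(i in S) M i j <= c.
      rewrite -(colM j) [leRHS](bigID (mem S)) /= lerDl.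
      exact: sumr_ge0.
    move=> Sk; move: k Sk.
    (* Rows in [S] have all their mass in the columns matched to [S], so the nonnegative column
       deficits add up to zero and each vanishes. *)
    have /eqP : \sum_(k in S) (c - \sum_(i in S) M i (u k)) = 0.
      rewrite big_split /= sumrN exchange_big /=.
      by rewrite -(eq_bigr _ rowS) subrr.
    rewrite psumr_eq0 => [/allP all0 k Sk|k _]; last by rewrite subr_ge0.
    have := all0 k (mem_index_enum _).
    by rewrite Sk subr_eq0 => /eqP <-.
  (* With no step from [S] back to [i0], the column of [i0] would carry no mass on [S],
     contradicting [0 < c]. *)
  have : \sum_(i in S) M i (u i0) = c by apply: colS; rewrite inE connect0.
  have [/existsP[k /andP[]]|] := boolP [exists k, (k \in S) && e k i0].
    by exists k.
  rewrite negb_exists => /forallP noe.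
  rewrite big1 => [c0|i Si]; first by rewrite -c0 ltxx in c_gt0.
  by move: (noe i); rewrite Si /= lt_def M_ge0 andbT negbK => /eqP.
move: Sk; rewrite inE => /cycle_of_connect/(_ ek)[s us si0].
have [r rP] := perm_rotate us.
(* Each row on the cycle takes the column of its successor, where its entry is positive; [i0] is
   gained and no matched row is lost. *)
exists (r * u)%g.
rewrite (bigD1 i0) //= Mi0 ltxx add0n [X in (_ < X)%N](bigD1 i0) //=.
have := rP i0; rewrite si0 /= => e0; rewrite permM e0 ltnS.
apply: leq_sum => i _; rewrite permM.
have := rP i; case: ifP => _ /=; first by move=> ->; case: (0 < _).
by move/eqP ->.
Qed.

(** A permutation meeting the most positive entries cannot be augmented, hence misses none. *)
Lemma perm_in_support c M :
  0 < c -> equal_line_sums c M -> exists u, forall i, 0 < M i (u i).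
Proof.
move=> c_gt0 Mc.
pose f u := (\sum_i (0 < M i (u i))%R)%N.
have [u _ umax] := @arg_maxnP _ 1%g predT f isT.
exists u => i; rewrite lt_def; case: (Mc) => -> _ _; rewrite andbT.
apply/negP => /eqP /(perm_augment c_gt0 Mc)[v].
by rewrite ltnNge => /negP; apply; apply: umax.
Qed.

(** Induction on the number of nonzero entries, peeling off one permutation of the support at a
    time. *)
Lemma birkhoff c M :
  equal_line_sums c M -> exists l : 'S_d -> F,
    (forall u, 0 <= l u) /\ M = \sum_u l u *: perm_mx u.
Proof.
have [n] := ubnP #|[pred ij | M ij.1 ij.2 != 0]|.
elim: n => // n IH in c M * => + Mc; rewrite ltnS => leMn.
have [i0 _|noI] := pickP (@predT 'I_d); last first.
  exists (fun=> 0); split=> //; apply/matrixP => i.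
  by have := noI i.
have [M_ge0 rowM colM] := Mc.
have c_ge0 : 0 <= c by rewrite -(rowM i0) sumr_ge0.
have [c0|c_neq0] := eqVneq c 0.
  exists (fun=> 0); split=> //; apply/matrixP => i j.
  rewrite summxE [RHS]big1 => [|u _]; last by rewrite scale0r mxE.
  have /eqP := rowM i; rewrite c0 psumr_eq0// => /allP/(_ j (mem_index_enum _)).
  by move/eqP.
have [u Mu] : exists u, forall i, 0 < M i (u i).
  by apply: (perm_in_support _ Mc); rewrite lt_def c_neq0.
have [k _ kmin] := @arg_minP _ _ _ i0 predT (fun i => M i (u i)) isT.
(* The least entry met by [u] is the largest multiple that can be removed while keeping [N]
   nonnegative; it clears position [(k, u k)]. *)
pose a := M k (u k); pose N := M - a *: perm_mx u.
have NE i j : N i j = M i j - a * (u i == j)%:R by rewrite !mxE.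
have [||l [l_ge0 Nl]] := IH (c - a) N.
- apply: leq_trans leMn; apply: proper_card; apply/properP; split.
    apply/fintype.subsetP => -[i j]; rewrite !inE /= NE.
    apply: contraNneq => Mij.
    have [uij|_] := eqVneq (u i) j; last by rewrite Mij mulr0 subr0.
    by have := Mu i; rewrite uij Mij ltxx.
  exists (k, u k); rewrite !inE /= ?NE ?eqxx ?mulr1 ?subrr ?eqxx//.
  by rewrite gt_eqF.
- split=> [i j|i|j].
  + rewrite NE; case: eqP => [<-|_]; rewrite ?mulr0 ?subr0// mulr1 subr_ge0.
    exact: kmin.
  + under eq_bigr do rewrite NE.
    rewrite big_split /= rowM sumrN -mulr_sumr; congr (_ - _).
    rewrite (bigD1 (u i)) //= eqxx big1 ?addr0 ?mulr1// => j.
    by rewrite eq_sym => /negPf->.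
  + under eq_bigr do rewrite NE.
    rewrite big_split /= colM sumrN -mulr_sumr; congr (_ - _).
    rewrite (bigD1 ((u^-1)%g j)) //= permKV eqxx big1 ?addr0 ?mulr1// => i.
    by case: (u i =P j) => [<-|]; rewrite ?permK ?eqxx.
exists (fun v => l v + a * (v == u)%:R); split=> [v|].
  by rewrite addr_ge0// mulr_ge0// ltW// Mu.
under eq_bigr do rewrite scalerDl.
rewrite big_split /= -Nl [X in _ = _ + X](bigD1 u) //= eqxx mulr1 big1 => [|v].
  by rewrite addr0 subrK.
by move=> /negPf->; rewrite mulr0 scale0r.
Qed.

End Birkhoff.

(** * Jensen's inequality for bistochastic matrices *)

(* Convexity of [f] enters through supporting lines at positive points only,
   because [x ln x] has none at 0. *)
Lemma sum_jensen (F : realFieldType) d (M : 'M[F]_d) (f : F -> F)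
    (r : 'I_d -> F) :
  equal_line_sums 1 M -> (forall k, 0 <= r k) -> f 0 = 0 ->
  (forall a, 0 < a -> exists b, forall x, 0 <= x -> f a + b * (x - a) <= f x) ->
  \sum_i f (\sum_k M i k * r k) <= \sum_k f (r k).
Proof.
move=> [M_ge0 rowM colM] r_ge0 f0 tangent.
(* Weighting each [f (r k)] by its column sum 1 and exchanging sums reduces the claim to Jensen's
   inequality in each row. *)
rewrite -[leRHS](eq_bigr _ (fun k _ => mul1r _)).
rewrite -[leRHS](eq_bigr _ (fun k _ => congr1 ( *%R^~ _) (colM k))).
under [leRHS]eq_bigr do rewrite mulr_suml.
rewrite exchange_big; apply: ler_sum => i _ /=.
set a := \sum_k _.
have Mr_ge0 k : 0 <= M i k * r k by rewrite mulr_ge0.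
have a_ge0 : 0 <= a by rewrite sumr_ge0.
have [a0|a_neq0] := eqVneq a 0.
  rewrite a0 f0 big1 // => k _.
  move/eqP: a0; rewrite psumr_eq0// => /allP/(_ k (mem_index_enum _)) /=.
  by rewrite mulf_eq0 => /orP[] /eqP->; rewrite ?f0 ?mul0r ?mulr0.
have [|b bP] := tangent a; first by rewrite lt_def a_neq0.
(* The slope term averages to zero because [a] is the mean of [r] under row [i]. *)
have -> : f a = \sum_k M i k * (f a + b * (r k - a)).
  under eq_bigr do rewrite mulrDr [b * _]mulrBr mulrBr mulrCA.
  rewrite big_split /= sumrB -!mulr_suml -mulr_sumr -/a rowM !mul1r.
  by rewrite subrr addr0.
by apply: ler_sum => k _; apply: ler_wpM2l => //; apply: bP.
Qed.

(** * Adjoints and the Hilbert-Schmidt norm *)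

Section Adjoint.
Variable C : numClosedFieldType.

Lemma adjmxM m n p (A : 'M[C]_(m, n)) (B : 'M[C]_(n, p)) :
  (A *m B) ^t* = B ^t* *m A ^t*.
Proof. by rewrite trmx_mul map_mxM. Qed.

Lemma adjmxZ m n a (A : 'M[C]_(m, n)) : (a *: A) ^t* = Num.conj a *: A ^t*.
Proof. by rewrite linearZ /= map_mxZ. Qed.

Lemma adjmx_mul_unitary n (W : 'M[C]_n) : W \is unitarymx -> W ^t* *m W = 1%:M.
Proof. by move/unitarymxP/mulmx1C. Qed.

Lemma mxtrace_mul_adjmx m n (A : 'M[C]_(m, n)) :
  \tr (A *m A ^t*) = \sum_i \sum_j `|A i j| ^+ 2.
Proof.
apply: eq_bigr => i _; rewrite mxE; apply: eq_bigr => j _.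
by rewrite !mxE normCK.
Qed.

Lemma mxtrace_mul_adjmx_eq0 m n (A : 'M[C]_(m, n)) :
  \tr (A *m A ^t*) = 0 -> A = 0.
Proof.
move/eqP; rewrite mxtrace_mul_adjmx psumr_eq0 => [/allP A0|i _]; last first.
  by rewrite sumr_ge0// => j _; rewrite exprn_ge0.
apply/matrixP => i j; have := A0 i (mem_index_enum _) => /=.
rewrite psumr_eq0 => [/allP/(_ j (mem_index_enum _))|k _]; last first.
  by rewrite exprn_ge0.
by rewrite /= expf_eq0 normr_eq0 mxE => /eqP.
Qed.

Lemma conj_mul_adjmx m n p (K : 'M[C]_(m, n)) (A : 'M[C]_(n, p)) :
  K *m (A *m A ^t*) *m K ^t* = (K *m A) *m (K *m A) ^t*.
Proof. by rewrite adjmxM !mulmxA. Qed.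

End Adjoint.

(** * Positive semidefinite matrices and complete positivity *)

Section Positivity.
Variable R : realType.
Local Notation C := R[i].

Lemma psdmx_conj m n (K : 'M[C]_(m, n)) (A : 'M[C]_n) :
  psdmx A -> psdmx (K *m A *m K ^t*).
Proof.
by move=> A_ge0 v; have := A_ge0 (K ^t* *m v); rewrite adjmxM trmxCK !mulmxA.
Qed.

Lemma psdmx_sum n (I : finType) (A : I -> 'M[C]_n) :
  (forall i, psdmx (A i)) -> psdmx (\sum_i A i).
Proof.
move=> A_ge0 v; rewrite mulmx_sumr mulmx_suml summxE.
by apply: sumr_ge0 => i _; apply: A_ge0.
Qed.

Lemma psdmx_mul_adjmx m n (A : 'M[C]_(m, n)) : psdmx (A *m A ^t*).
Proof.
move=> v.
have -> : v ^t* *m (A *m A ^t*) *m v = (A ^t* *m v) ^t* *m (A ^t* *m v).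
  by rewrite adjmxM trmxCK !mulmxA.
by rewrite mxE sumr_ge0// => i _; rewrite !mxE mulrC mul_conjC_ge0.
Qed.

(** Tensoring a Kraus operator with the identity gives a block-diagonal matrix, so the amplified map
    is a sum of conjugations, each preserving positivity. *)
Lemma kraus_completely_positive d (I : finType) (K : I -> 'M[C]_d) E :
  (forall Y, E Y = \sum_n K n *m Y *m (K n) ^t*) -> completely_positive E.
Proof.
move=> EE; split=> [a Y Z|k Y Y_ge0].
  rewrite !EE scaler_sumr -big_split; apply: eq_bigr => n _ /=.
  by rewrite mulmxDr mulmxDl -scalemxAr -scalemxAl.
have -> : \mxblock_(i < k, j < k) E (Y i j) =
    \sum_n \mxdiag_(i < k) K n *m (\mxblock_(i < k, j < k) Y i j)
           *m (\mxdiag_(i < k) K n) ^t*.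
  have adjD n : (\mxdiag_(i < k) K n) ^t* = \mxdiag_(i < k) (K n) ^t*.
    rewrite tr_mxdiag; apply/matrixP => i j; rewrite !mxE.
    case: eqP => [e|_]; rewrite ?mxE ?conjC0//.
    by rewrite !conform_mx_id !mxE.
  under [RHS]eq_bigr do rewrite adjD mul_mxdiag_mxblock mul_mxblock_mxdiag.
  by rewrite -mxblock_sum; apply/eq_mxblock => i j; rewrite EE.
by apply: psdmx_sum => n; apply: psdmx_conj.
Qed.

End Positivity.

(** * Incoherent conversion of pure states *)

Section Conversion.
Variables (R : realType) (d : nat).
Local Notation C := R[i].
Implicit Types (B : 'I_d -> 'M[C]_d) (W M : 'M[C]_d) (u v x y : 'cV[C]_d).

(** Passes to the totally ordered field [R], over which Birkhoff's theorem is proved. *)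
Lemma bistochastic_real M : bistochastic M ->
  exists2 N : 'M[R]_d, equal_line_sums 1 N & forall i j, M i j = (N i j)%:C.
Proof.
move=> [M_ge0 rowM colM]; exists (map_mx (@complex.Re R) M) => [|i j].
  have ReM i j : (complex.Re (M i j))%:C = M i j by rewrite RRe_real ?ger0_real.
  split=> [i j|i|j].
  - by rewrite mxE -ler0c ReM.
  - apply: (@complexI R); rewrite rmorph_sum /= rmorph1 -(rowM i).
    by apply: eq_bigr => j _; rewrite mxE ReM.
  - apply: (@complexI R); rewrite rmorph_sum /= rmorph1 -(colM j).
    by apply: eq_bigr => i _; rewrite mxE ReM.
by rewrite mxE RRe_real ?ger0_real.
Qed.

(** Birkhoff's decomposition applied to vectors. The weights sum to 1 by taking [f = 1] in the row
    [i0]. *)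
Lemma bistochastic_mixture M (i0 : 'I_d) : bistochastic M ->
  exists l : 'S_d -> C, [/\ forall s, 0 <= l s, \sum_s l s = 1
    & forall i (f : 'I_d -> C), \sum_k M i k * f k = \sum_s l s * f (s i)].
Proof.
move=> /bistochastic_real[N N1 MN].
have [l [l_ge0 Nl]] := birkhoff N1.
have mix i (f : 'I_d -> C) :
    \sum_k M i k * f k = \sum_s (l s)%:C * f (s i).
  have MNl k : M i k * f k = \sum_s (l s)%:C * (s i == k)%:R * f k.
    rewrite MN Nl summxE rmorph_sum mulr_suml; apply: eq_bigr => s _ /=.
    by rewrite !mxE rmorphM rmorph_nat.
  rewrite (eq_bigr _ (fun k _ => MNl k)) exchange_big; apply: eq_bigr => s _ /=.
  rewrite (bigD1 (s i)) //= big1 => [|k].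
    by rewrite eqxx mulr1 addr0.
  by rewrite eq_sym => /negPf->; rewrite mulr0 mul0r.
exists (fun s => (l s)%:C); split=> // [s|]; first by rewrite ler0c.
have := mix i0 (fun=> 1).
under [RHS]eq_bigr do rewrite mulr1.
move=> <-; under eq_bigr do rewrite mulr1 MN.
by rewrite -rmorph_sum /=; case: N1 => _ -> _; rewrite rmorph1.
Qed.

(** Each [K s] is a permutation matrix with rescaled columns, so [(K s) ^t* *m K s] is diagonal with
    entries [|a s i| ^ 2], and these sum to 1 over [s]. *)
Lemma majorized_kraus (l : 'S_d -> C) x y :
  (forall s, 0 <= l s) -> \sum_s l s = 1 ->
  (forall i, `|x i 0| ^+ 2 = \sum_s l s * `|y (s i) 0| ^+ 2) ->
  exists K : 'S_d -> 'M[C]_d,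
    [/\ forall s, K s *m x = sqrtC (l s) *: y,
        \sum_s (K s) ^t* *m K s = 1%:M
      & forall s i, exists a,
          K s *m delta_mx i (0 : 'I_1) = a *: delta_mx (s i) 0].
Proof.
move=> l_ge0 l1 xy.
pose a (s : 'S_d) i :=
  sqrtC (l s) * (if x i 0 == 0 then 1 else y (s i) 0 / x i 0).
have normsqrt s : `|sqrtC (l s)| ^+ 2 = l s.
  by rewrite ger0_norm ?sqrtC_ge0// sqrtCK.
have ax s i : a s i * x i 0 = sqrtC (l s) * y (s i) 0.
  rewrite /a; case: ifPn => [/eqP x0|x0]; last by rewrite mulrA divfK.
  (* Where [x i 0] vanishes, so does every term of the mixture, hence
     [sqrtC (l s) * y (s i) 0 = 0]. *)
  rewrite x0 mulr0; apply/esym/eqP; rewrite -normr_eq0 -sqrf_eq0.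
  rewrite normrM exprMn normsqrt.
  have /esym/eqP := xy i; rewrite x0 normr0 expr0n /= psumr_eq0.
    by move=> /allP/(_ s (mem_index_enum _)).
  by move=> t _; rewrite mulr_ge0// exprn_ge0.
have a1 i : \sum_s `|a s i| ^+ 2 = 1.
  have [x0|x0] := eqVneq (x i 0) 0.
    by rewrite -l1; apply: eq_bigr => s _; rewrite /a x0 eqxx mulr1 normsqrt.
  have nx0 : `|x i 0| ^+ 2 != 0 by rewrite sqrf_eq0 normr_eq0.
  apply: (mulIf nx0); rewrite mul1r mulr_suml [RHS]xy; apply: eq_bigr => s _.
  by rewrite -exprMn -normrM ax normrM exprMn normsqrt.
exists (fun s => \matrix_(k, i) (a s i * (k == s i)%:R)); split=> [s||s i].
- apply/matrixP => k j; rewrite ord1 !mxE.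
  rewrite (bigD1 ((s^-1)%g k)) //= big1 => [|i].
    by rewrite addr0 mxE permKV eqxx mulr1 ax permKV.
  by rewrite mxE; case: (k =P s i) => [->|]; rewrite ?permK ?eqxx// mulr0 mul0r.
- apply/matrixP => i j; rewrite summxE.
  have E s : (((\matrix_(k, i) (a s i * (k == s i)%:R)) ^t*)
      *m (\matrix_(k, i) (a s i * (k == s i)%:R))) i j
     = `|a s i| ^+ 2 *+ (i == j).
    rewrite mxE (bigD1 (s i)) //= big1 => [|k /negPf ki].
      rewrite !mxE eqxx mulr1 addr0 (inj_eq perm_inj).
      by case: eqP => [->|_]; rewrite ?mulr0// mulr1 normCK mulrC.
    by rewrite !mxE ki mulr0 conjC0 mul0r.
  by rewrite (eq_bigr _ (fun s _ => E s)) sumrMnl a1 mxE.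
- exists (a s i); rewrite -colE; apply/matrixP => k j.
  by rewrite ord1 !mxE eqxx andbT.
Qed.

Lemma vector_basisE B W : vector_basis_of B W ->
  forall i,
    B i = (W *m delta_mx i (0 : 'I_1)) *m (W *m delta_mx i (0 : 'I_1)) ^t*.
Proof. by move=> [_ BW] i; rewrite BW colE. Qed.

Lemma vector_basis_diag B W i : vector_basis_of B W ->
  W ^t* *m B i *m W = delta_mx i i.
Proof.
move=> BW; rewrite (vector_basisE BW); case: BW => uW _.
rewrite adjmxM !mulmxA adjmx_mul_unitary// mul1mx -!mulmxA adjmx_mul_unitary//.
rewrite mulmx1; apply/matrixP => k l.
by rewrite !mxE big_ord1 !mxE eqxx !andbT conjC_nat -natrM mulnb.
Qed.

Lemma basis_inj B : is_basis B -> injective B.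
Proof.
move=> /vector_basis_exists[W BW] i j Bij.
have := vector_basis_diag i BW; rewrite Bij (vector_basis_diag j BW).
move=> /matrixP/(_ i i); rewrite !mxE eqxx andbb.
by case: eqP => // _ /esym/eqP; rewrite oner_eq0.
Qed.

(** The Born rule for the vector [u] measured in the basis [B]. *)
Lemma mxtrace_basis_pure B W i u : vector_basis_of B W ->
  \tr (B i *m (u *m u ^t*)) = `|(W ^t* *m u) i 0| ^+ 2.
Proof.
move=> [_ BW]; rewrite BW -mulmxA mxtrace_mulC !mulmxA -(mulmxA _ _ (col i W)).
set w := col i W; have -> : (W ^t* *m u) i 0 = (w ^t* *m u) 0 0.
  by rewrite !mxE; apply: eq_bigr => k _; rewrite !mxE.
have -> : u ^t* *m w = (w ^t* *m u) ^t* by rewrite adjmxM trmxCK.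
by rewrite mxtrace_mul_adjmx !big_ord1.
Qed.

(** The Kraus operators built on amplitudes are carried back by [W]; each maps [B i] to a multiple
    of [B (s i)], which gives incoherence. *)
Lemma pure_state_conversion B W M (i0 : 'I_d) u v :
  vector_basis_of B W -> bistochastic M ->
  (forall i, `|(W ^t* *m u) i 0| ^+ 2 =
             \sum_k M i k * `|(W ^t* *m v) k 0| ^+ 2) ->
  exists E, incoherent_operation B E /\ E (u *m u ^t*) = v *m v ^t*.
Proof.
move=> BW bM uv; have uW := BW.1.
have [l [l_ge0 l1 mix]] := bistochastic_mixture i0 bM.
have [|K [Ku K1 Kdiag]] :=
  @majorized_kraus l (W ^t* *m u) (W ^t* *m v) l_ge0 l1.
  by move=> i; rewrite uv (mix i (fun k => `|(W ^t* *m v) k 0| ^+ 2)).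
have WW : W *m W ^t* = 1%:M by apply/unitarymxP.
pose L s := W *m K s *m W ^t*.
pose E Y := \sum_s L s *m Y *m (L s) ^t*.
exists E; split; first split.
- exact: (kraus_completely_positive (K := L)).
- move=> Y; rewrite /E raddf_sum /=.
  under eq_bigr do rewrite mxtrace_mulC mulmxA.
  rewrite -raddf_sum -mulmx_suml; congr (\tr _).
  rewrite -[RHS]mul1mx; congr (_ *m _).
  under eq_bigr do rewrite /L !adjmxM trmxCK -!mulmxA [W ^t* *m (W *m _)]mulmxA
    adjmx_mul_unitary// mul1mx [(K _) ^t* *m _]mulmxA mulmxA.
  by rewrite -mulmx_suml -mulmx_sumr K1 mulmx1.
(* Kraus families are indexed by ordinals, so the permutations are enumerated. *)
- exists #|{perm 'I_d}|, (fun n => L (enum_val n)); split=> [Y|n Y _ [p ->]].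
    by rewrite /E (reindex _ (onW_bij _ (enum_val_bij {perm 'I_d}))).
  set s := enum_val n.
  have LB i : exists c, L s *m B i *m (L s) ^t* = c *: B (s i).
    have [a Ka] := Kdiag s i; exists (a * Num.conj a).
    rewrite !(vector_basisE BW) conj_mul_adjmx.
    have -> : L s *m (W *m delta_mx i (0 : 'I_1))
        = a *: (W *m delta_mx (s i) 0).
      by rewrite /L -!mulmxA [W ^t* *m _]mulmxA adjmx_mul_unitary// mul1mx Ka
        scalemxAr.
    by rewrite adjmxZ -scalemxAl -scalemxAr scalerA.
  have [c LBc] := choice LB.
  exists (fun k => p ((s^-1)%g k) * c ((s^-1)%g k)).
  rewrite mulmx_sumr mulmx_suml [RHS](reindex_inj (@perm_inj _ s)).
  by apply: eq_bigr => i _; rewrite permK -scalemxAr -scalemxAl LBc scalerA.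
- rewrite /E.
  have Lu s : L s *m u = sqrtC (l s) *: v.
    by rewrite /L -!mulmxA Ku -scalemxAr mulmxA WW mul1mx.
  have E1 s : L s *m (u *m u ^t*) *m (L s) ^t* = l s *: (v *m v ^t*).
    rewrite conj_mul_adjmx Lu adjmxZ -scalemxAl -scalemxAr scalerA -normCK.
    by rewrite ger0_norm ?sqrtC_ge0// sqrtCK.
  by rewrite (eq_bigr _ (fun s _ => E1 s)) -scaler_suml l1 scale1r.
Qed.

(** Turns equality of bases as sets into a relabelling of their enumerations. *)
Lemma range_basis_perm B B' : is_basis B' -> range B = range B' ->
  exists s : 'S_d, forall i, B (s i) = B' i.
Proof.
move=> /basis_inj inj' BB'.
have ex i : exists k, B k = B' i.
  have : range B (B' i) by rewrite BB'; exists i.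
  by case=> k _ <-; exists k.
have [f fP] := choice ex.
have f_inj : injective f by move=> i j fij; apply: inj'; rewrite -!fP fij.
by exists (perm f_inj) => i; rewrite permE.
Qed.

End Conversion.

(** * Supporting lines of the two convex functions *)

(** The slope is the derivative [1 + ln a]. For [x > 0] the claim is [ln y <= y - 1] at [y = a / x];
    at [x = 0] it reads [- a <= 0]. *)
Lemma xlnx_tangent (R : realType) (a : R) : 0 < a ->
  exists b, forall x, 0 <= x -> a * ln a + b * (x - a) <= x * ln x.
Proof.
move=> a_gt0; exists (1 + ln a) => x; rewrite le_eqVlt => /predU1P[<-|x_gt0].
  by rewrite sub0r mul0r mulrN mulrDl mul1r opprD [_ * a]mulrC addrCA subrr
    addr0 oppr_le0 ltW.
have : ln (1 + (a / x - 1)) <= a / x - 1.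
  by apply: le_ln1Dx; rewrite ltrBDr addNr divr_gt0.
rewrite [1 + _]addrC subrK ln_div// -subr_ge0 => h.
rewrite -subr_ge0.
have -> : x * ln x - (a * ln a + (1 + ln a) * (x - a))
  = x * (a / x - 1 - (ln a - ln x)).
  by field; rewrite gt_eqF.
by rewrite mulr_ge0// ltW.
Qed.

Lemma sqr_tangent (R : realFieldType) (a : R) :
  exists b, forall x, a ^+ 2 + b * (x - a) <= x ^+ 2.
Proof.
exists (2 * a) => x; rewrite -subr_ge0.
have -> : x ^+ 2 - (a ^+ 2 + 2 * a * (x - a)) = (x - a) ^+ 2 by ring.
exact: sqr_ge0.
Qed.

(** * Functional calculus and coherences in terms of outcome probabilities *)

Section Spectral.
Variables (R : realType) (d : nat).
Local Notation C := R[i].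
Implicit Types (B : 'I_d -> 'M[C]_d) (rho W S : 'M[C]_d) (t s : 'rV[C]_d).

(* The unitary [S *m W] intertwines the two diagonal matrices, so it has a
   nonzero entry only where the corresponding eigenvalues coincide. *)
Lemma unitary_diag_map (f : C -> C) W S t s :
  W \is unitarymx -> S \is unitarymx ->
  S ^t* *m diag_mx s *m S = W *m diag_mx t *m W ^t* ->
  S ^t* *m diag_mx (map_mx f s) *m S = W *m diag_mx (map_mx f t) *m W ^t*.
Proof.
move=> uW uS e; have WW := adjmx_mul_unitary uW.
have SS : S *m S ^t* = 1%:M by apply/unitarymxP.
have WW' : W *m W ^t* = 1%:M by apply/unitarymxP.
have SS' := adjmx_mul_unitary uS.
have sQt : diag_mx s *m (S *m W) = S *m W *m diag_mx t.
  have : S *m (S ^t* *m diag_mx s *m S) *m W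
      = S *m (W *m diag_mx t *m W ^t*) *m W.
    by rewrite e.
  by rewrite !mulmxA SS mul1mx -!mulmxA WW mulmx1.
have fsQt : diag_mx (map_mx f s) *m (S *m W) = S *m W *m diag_mx (map_mx f t).
  move: (S *m W) sQt => Q /matrixP sQt; apply/matrixP => i j.
  have := sQt i j.
  rewrite !mul_diag_mx !mul_mx_diag !mxE [X in X = _ -> _]mulrC.
  have [->|Qij /(mulfI Qij) ->] := eqVneq (Q i j) 0; last by rewrite mulrC.
  by rewrite !mulr0 !mul0r.
rewrite -[LHS]mulmx1 -WW' mulmxA -(mulmxA _ S W) -(mulmxA (S ^t*) _ (S *m W)).
by rewrite fsQt !mulmxA SS' mul1mx.
Qed.

(** Any unitary diagonalization computes the logarithm, not only the one chosen by [spectralmx]. *)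
Lemma mxlogE W t : W \is unitarymx ->
  mxlog (W *m diag_mx t *m W ^t*) =
  W *m diag_mx (map_mx (fun z : C => (ln (complex.Re z))%:C) t) *m W ^t*.
Proof.
move=> uW; set Y := W *m _ *m _.
have /orthomx_spectralP : Y \is normalmx.
  apply/orthomx_spectral_subproof.
  exists (W ^t*, t); rewrite /= ?trmxC_unitary//.
  by rewrite invmx_unitary ?trmxC_unitary// trmxCK.
have uS := spectral_unitarymx Y.
by rewrite /mxlog invmx_unitary// => /esym; apply: unitary_diag_map.
Qed.

Lemma sum_basisE B W (t : 'I_d -> C) : vector_basis_of B W ->
  \sum_i t i *: B i = W *m diag_mx (\row_i t i) *m W ^t*.
Proof.
move=> BW; rewrite diag_mx_sum_delta mulmx_sumr mulmx_suml.
apply: eq_bigr => i _; rewrite mxE -scalemxAr -scalemxAl (vector_basisE BW).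
rewrite -conj_mul_adjmx; congr (_ *: (_ *m _ *m _)).
apply/matrixP => k l.
by rewrite !mxE big_ord1 !mxE eqxx !andbT conjC_nat -natrM mulnb.
Qed.

Lemma mxtrace_basisE B W Y i : vector_basis_of B W ->
  \tr (B i *m Y) = (W ^t* *m Y *m W) i i.
Proof.
move=> [_ BW]; rewrite BW -mulmxA mxtrace_mulC.
rewrite /mxtrace big_ord1 !mxE; apply: eq_bigr => k _; rewrite !mxE.
by congr (_ * _); apply: eq_bigr => l _; rewrite !mxE.
Qed.

Lemma mxtrace_basis_ge0 B Y i : is_basis B -> psdmx Y -> 0 <= \tr (B i *m Y).
Proof.
move=> /vector_basis_exists[W [_ BW]] Y_ge0.
by rewrite BW -mulmxA mxtrace_mulC /mxtrace big_ord1; apply: Y_ge0.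
Qed.

Lemma basis_psdmx B i : is_basis B -> psdmx (B i).
Proof.
by move=> /vector_basis_exists[W [_ ->]]; apply: psdmx_mul_adjmx.
Qed.

(** As [B i] has rank one, [B i *m rho *m B i] is [\tr (B i *m rho)] times [B i]. *)
Lemma dephaseE B W rho : vector_basis_of B W ->
  dephase B rho = W *m diag_mx (\row_i \tr (B i *m rho)) *m W ^t*.
Proof.
move=> BW; rewrite -(sum_basisE _ BW); apply: eq_bigr => i _.
case: BW => _ BW; rewrite BW.
rewrite -[(_ *m _) *m rho]mulmxA mxtrace_mulC -!mulmxA.
rewrite [rho *m (_ *m _)]mulmxA [_ *m (_ *m _ *m _)]mulmxA.
rewrite [_ *m (rho *m _)]mulmxA.
rewrite [_ ^t* *m rho *m _]mx11_scalar mul_scalar_mx -scalemxAr.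
by rewrite mxtrace_scalar mulr1n.
Qed.

Lemma diagonal_state_coef B (p : 'I_d -> C) : is_basis B ->
  psdmx (\sum_i p i *: B i) -> forall i, 0 <= p i.
Proof.
move=> hB rho_ge0 i; have := mxtrace_basis_ge0 i hB rho_ge0.
have [W BW] := vector_basis_exists hB; have [uW _] := BW.
rewrite (mxtrace_basisE _ _ BW) (sum_basisE _ BW) !mulmxA adjmx_mul_unitary//.
by rewrite mul1mx -mulmxA adjmx_mul_unitary// mulmx1 !mxE eqxx mulr1n.
Qed.

(** The overlap of two projectors is the squared Hilbert-Schmidt norm of their product. *)
Lemma overlap_eq0 B B' i j : is_basis B -> is_basis B' ->
  \tr (B i *m B' j) = 0 -> B' j *m B i = 0.
Proof.
move=> [projB _] [projB' _].
have [hB BB _] := projB i; have [hB' BB' _] := projB' j.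
rewrite -{1}BB -{1}BB' -mulmxA mxtrace_mulC => tr0.
apply: mxtrace_mul_adjmx_eq0; rewrite -[RHS]tr0 adjmxM hB hB'.
by rewrite mxtrace_mulC !mulmxA mxtrace_mulC !mulmxA.
Qed.

(** Makes the relative entropy finite. If outcome [i] has probability zero, every [B0 j] of nonzero
    weight is orthogonal to [B i], so [rho *m B i = 0]. *)
Lemma diagonal_state_support B0 B rho : is_basis B0 -> is_basis B ->
  is_state rho -> diagonal_in B0 rho -> (rho <= dephase B rho)%MS.
Proof.
move=> hB0 hB [rho_ge0 _] [p rhoE].
have p_ge0 : forall j, 0 <= p j.
  by apply: (diagonal_state_coef hB0); rewrite -rhoE.
have ker i : \tr (B i *m rho) = 0 -> rho *m B i = 0.
  rewrite rhoE mulmx_sumr mulmx_suml raddf_sum /=.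
  under eq_bigr do rewrite -scalemxAr mxtraceZ.
  move/eqP; rewrite psumr_eq0 => [/allP X0|j _]; last first.
    by rewrite mulr_ge0// mxtrace_basis_ge0//; apply: basis_psdmx.
  apply: big1 => j _; have := X0 j (mem_index_enum _).
  rewrite /= mulf_eq0 => /orP[/eqP->|/eqP/overlap_eq0 BB].
    by rewrite scale0r mul0mx.
  by rewrite -scalemxAl BB// scaler0.
have [W BW] := vector_basis_exists hB; have [uW _] := BW.
rewrite (dephaseE _ BW); apply/submxP.
(* [rho] times the inverse of the dephased state on its support; since [0^-1 = 0], null outcomes
   contribute nothing. *)
exists (rho *m W *m diag_mx (\row_i (\tr (B i *m rho))^-1) *m W ^t*).
rewrite -!mulmxA [W ^t* *m (W *m _)]mulmxA adjmx_mul_unitary// mul1mx.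
rewrite [diag_mx _ *m (_ *m _)]mulmxA mulmx_diag.
have [_ sumB] := hB; rewrite -[LHS]mulmx1 -sumB.
set t := (X in diag_mx X).
have -> : t = \row_i ((\tr (B i *m rho))^-1 * \tr (B i *m rho)).
  by apply/rowP => i; rewrite !mxE.
rewrite [W *m _]mulmxA -(sum_basisE _ BW) !mulmx_sumr; apply: eq_bigr => i _.
have [t0|t0] := eqVneq (\tr (B i *m rho)) 0; last by rewrite mulVf// scale1r.
by rewrite t0 mulr0 scale0r mulmx0 ker.
Qed.

Lemma basis_prob_real B rho i : is_basis B -> psdmx rho ->
  (complex.Re (\tr (B i *m rho)))%:C = \tr (B i *m rho).
Proof. by move=> hB hr; rewrite RRe_real// ger0_real// mxtrace_basis_ge0. Qed.

Lemma rel_coherenceE B rho : is_basis B -> psdmx rho ->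
  (rho <= dephase B rho)%MS ->
  rel_coherence B rho =
    (complex.Re (\tr (rho *m mxlog rho)) -
     \sum_i (let r := complex.Re (\tr (B i *m rho)) in r * ln r))%:E.
Proof.
move=> hB hr supp; rewrite /rel_coherence /relative_entropy supp; congr (_%:E).
rewrite raddfB /=; congr (_ - _).
have [W BW] := vector_basis_exists hB; have [uW _] := BW.
rewrite (dephaseE _ BW) mxlogE//.
set t := map_mx _ _.
have -> : t = \row_i (ln (complex.Re (\tr (B i *m rho))))%:C.
  by apply/rowP => i; rewrite !mxE.
rewrite -(sum_basisE _ BW) mulmx_sumr (raddf_sum (@mxtrace C d)) raddf_sum /=.
apply: eq_bigr => i _; rewrite -scalemxAr mxtraceZ [\tr (rho *m _)]mxtrace_mulC.
by rewrite -{2}(basis_prob_real i hB hr) -rmorphM mulrC.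
Qed.

(** The full sum of squared moduli is unitarily invariant; the diagonal entries removed from it are
    the outcome probabilities. *)
Lemma coherence2_sqr B rho : is_basis B -> psdmx rho ->
  coherence2 B rho = complex.Re (\tr (rho *m rho ^t*)) -
    \sum_i complex.Re (\tr (B i *m rho)) ^+ 2.
Proof.
move=> hB hr; have [W BW] := vector_basis_exists hB; have [uW _] := BW.
rewrite (coherence2E _ BW) /offdiag_sqnorm.
have WW' : W *m W ^t* = 1%:M by apply/unitarymxP.
set Y := W ^t* *m rho *m W.
have -> : \tr (rho *m rho ^t*) = \sum_i \sum_j `|Y i j| ^+ 2.
  rewrite -mxtrace_mul_adjmx /Y !adjmxM trmxCK -!mulmxA.
  by rewrite [W *m (W ^t* *m _)]mulmxA WW' mul1mx [RHS]mxtrace_mulC -!mulmxA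
    WW' mulmx1.
have Yii i : complex.Re (\tr (B i *m rho)) ^+ 2 = complex.Re (`|Y i i| ^+ 2).
  rewrite -(mxtrace_basisE _ _ BW) -[in RHS](basis_prob_real i hB hr).
  by rewrite real_normK ?complex_real// -rmorphXn.
rewrite raddf_sum -sumrB; apply: eq_bigr => i _.
by rewrite Yii raddf_sum [X in _ = X - _](bigD1 i) //= addrAC subrr add0r.
Qed.

(** Outcome probabilities of a state diagonal in [B0] are linear in the rows of the overlap
    matrix. *)
Lemma majorized_basis_prob B0 B1 B2 M rho :
  overlap B2 B0 = M *m overlap B1 B0 -> diagonal_in B0 rho ->
  forall i, \tr (B2 i *m rho) = \sum_k M i k * \tr (B1 k *m rho).
Proof.
move=> /matrixP XM [p ->] i.
have trB B k : \tr (B k *m \sum_j p j *: B0 j) = \sum_j p j * overlap B B0 k j.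
  rewrite mulmx_sumr (raddf_sum (@mxtrace C d)); apply: eq_bigr => j _ /=.
  by rewrite -scalemxAr mxtraceZ mxE.
under [RHS]eq_bigr do rewrite trB mulr_sumr.
rewrite trB exchange_big; apply: eq_bigr => j _ /=.
by rewrite XM mxE mulr_sumr; apply: eq_bigr => k _; rewrite mulrCA.
Qed.

Lemma majorizes_sum_convex B0 B1 B2 rho (f : R -> R) :
  is_basis B1 -> is_basis B2 -> majorizes B0 B1 B2 ->
  psdmx rho -> diagonal_in B0 rho -> f 0 = 0 ->
  (forall a, 0 < a -> exists b, forall x, 0 <= x -> f a + b * (x - a) <= f x) ->
  \sum_i f (complex.Re (\tr (B2 i *m rho)))
    <= \sum_i f (complex.Re (\tr (B1 i *m rho))).
Proof.
move=> hB1 hB2 [M bM XM] hr drho f0 ftangent.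
have [N N1 MN] := bistochastic_real bM.
have r2E i : complex.Re (\tr (B2 i *m rho)) =
    \sum_k N i k * complex.Re (\tr (B1 k *m rho)).
  apply: (@complexI R); rewrite basis_prob_real// rmorph_sum.
  rewrite (majorized_basis_prob XM drho); apply: eq_bigr => k _ /=.
  by rewrite rmorphM /= basis_prob_real// MN.
under eq_bigr do rewrite r2E.
apply: (sum_jensen N1) => // k.
by rewrite -ler0c basis_prob_real// mxtrace_basis_ge0.
Qed.

End Spectral.

(** * Conversion between the given bases and conclusion *)

Lemma majorizes_pure_conversion (R : realType) (d : nat)
    (B0 B1 B2 : 'I_d -> 'M[R[i]]_d) (U V : 'M[R[i]]_d -> 'M[R[i]]_d)
    (j : 'I_d) :
  is_basis B0 -> majorizes B0 B1 B2 -> unitary_map U -> unitary_map V ->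
  range (fun i => U (B1 i)) = range B0 ->
  range (fun i => V (B2 i)) = range B0 ->
  exists E, incoherent_operation B0 E /\ E (V (B0 j)) = U (B0 j).
Proof.
move=> hB0 [M bM XM] [u uu UE] [v uv VE].
move=> /(range_basis_perm hB0)[s sP] /(range_basis_perm hB0)[t tP].
have [W BW] := vector_basis_exists hB0.
set b := W *m delta_mx j (0 : 'I_1).
have pureE (w : 'M[R[i]]_d) : w *m B0 j *m w ^t* = (w *m b) *m (w *m b) ^t*.
  by rewrite (vector_basisE BW) conj_mul_adjmx.
rewrite VE UE !pureE.
have amp (B : 'I_d -> 'M[R[i]]_d) (w : 'M[R[i]]_d) k i : w \is unitarymx ->
    w *m B k *m w ^t* = B0 i ->
    `|(W ^t* *m (w *m b)) i 0| ^+ 2 = overlap B B0 k j.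
  move=> uw Bk; rewrite -(mxtrace_basis_pure _ _ BW) -Bk -pureE mxE.
  rewrite !mulmxA -(mulmxA _ (w ^t*) w) adjmx_mul_unitary// mulmx1.
  by rewrite mxtrace_mulC !mulmxA adjmx_mul_unitary// mul1mx.
(* [U] and [V] match the enumerations up to [s] and [t], so [M] is relabelled accordingly and stays
   bistochastic. *)
pose M' := \matrix_(i, k) M (t i) (s k).
apply: (@pure_state_conversion _ _ B0 W M' j) => //.
  case: bM => M_ge0 rowM colM; split=> [i k|i|k]; first by rewrite mxE.
    rewrite -(rowM (t i)) [RHS](reindex_inj (@perm_inj _ s)).
    by apply: eq_bigr => k _; rewrite mxE.
  rewrite -(colM (s k)) [RHS](reindex_inj (@perm_inj _ t)).
  by apply: eq_bigr => i _; rewrite mxE.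
move=> i; rewrite (amp B2 v (t i)) ?XM//; last by rewrite -VE tP.
rewrite mxE (reindex_inj (@perm_inj _ s)); apply: eq_bigr => k _ /=.
by rewrite (amp B1 u (s k) k) ?[M' _ _]mxE// -UE sP.
Qed.

Lemma unitary_map_state (R : realType) (d : nat)
    (U : 'M[R[i]]_d -> 'M[R[i]]_d) Y :
  unitary_map U -> is_state Y -> is_state (U Y).
Proof.
move=> [u uu UE] [Y_ge0 trY]; rewrite UE; split; first exact: psdmx_conj.
by rewrite mxtrace_mulC mulmxA adjmx_mul_unitary// mul1mx.
Qed.

Lemma basis_state (R : realType) (d : nat) (B : 'I_d -> 'M[R[i]]_d) i :
  is_basis B -> is_state (B i).
Proof.
move=> hB; split; first exact: basis_psdmx.
have [W BW] := vector_basis_exists hB.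
have [_ BB _] := hB.1 i.
by rewrite -BB (mxtrace_basisE _ _ BW) (vector_basis_diag _ BW) mxE eqxx.
Qed.

Theorem proposition3 (R : realType) (d : nat) (B0 B1 B2 : 'I_d -> 'M[R[i]]_d)
    (hB0 : is_basis B0) (hB1 : is_basis B1) (hB2 : is_basis B2)
    (hmaj : majorizes B0 B1 B2) :
  (forall (U V : 'M[R[i]]_d -> 'M[R[i]]_d),
     unitary_map U -> unitary_map V ->
     range (fun i => U (B1 i)) = range B0 ->
     range (fun i => V (B2 i)) = range B0 ->
     forall j : 'I_d,
       (exists E : 'M[R[i]]_d -> 'M[R[i]]_d,
          incoherent_operation B0 E /\ E (V (B0 j)) = U (B0 j)) /\
       (forall c : 'M[R[i]]_d -> R,
          coherence_measure B0 c -> c (U (B0 j)) <= c (V (B0 j))))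
  /\
  (forall rho0 : 'M[R[i]]_d,
     is_state rho0 -> diagonal_in B0 rho0 ->
     (rel_coherence B1 rho0 <= rel_coherence B2 rho0)%E /\
     coherence2 B1 rho0 <= coherence2 B2 rho0).
Proof.
split=> [U V uU uV UB VB j|rho srho drho].
  have [E [incE EVU]] := majorizes_pure_conversion j hB0 hmaj uU uV UB VB.
  split; first by exists E.
  move=> c cP; rewrite -EVU; apply: cP => //.
  by apply: unitary_map_state => //; apply: basis_state.
have [rho_ge0 _] := srho; split.
  rewrite !rel_coherenceE//; try exact: diagonal_state_support hB0 _ srho drho.
  (* The basis-independent term cancels, and the sign reverses the convex inequality. *)
  rewrite lee_fin lerD2l lerN2.
  apply: (majorizes_sum_convex (f := fun x => x * ln x)
    hB1 hB2 hmaj rho_ge0 drho) => [|a]; last exact: xlnx_tangent.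
  by rewrite mul0r.
rewrite !coherence2_sqr// lerD2l lerN2.
apply: (majorizes_sum_convex (f := fun x => x ^+ 2)
  hB1 hB2 hmaj rho_ge0 drho) => [|a _]; first by rewrite expr0n.
by have [b bP] := sqr_tangent a; exists b => x _.
Qed.
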